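(* Let $(L,\cdot,\circ)$ be a pre-Lie Poisson algebra. Define $[x,y]=x\circ y-y\circ x$ for all $x,y\in L$. Then $(L,\cdot,[\;,\;])$ is a transposed Poisson algebra.
   Context: All vector spaces are over a field $K$ of characteristic zero. Commutative associative algebras are not assumed unital. A pre-Lie Poisson algebra is a triple $(L,\cdot,\circ)$, where $L$ is a vector space and $\cdot,\circ$ are bilinear operations on $L$ such that: (1) $(L,\cdot)$ is a commutative associative algebra; (2) $(L,\circ)$ is a pre-Lie algebra, i.e. $(x\circ y)\circ z-(y\circ x)\circ z=x\circ(y\circ z)-y\circ(x\circ z)$ for all $x,y,z\in L$; (3) for all $x,y,z\in L$, $(x\cdot y)\circ z=x\cdot(y\circ z)$ and $(x\circ y)\cdot z-(y\circ x)\cdot z=x\circ(y\cdot z)-y\circ(x\cdot z)$. A transposed Poisson algebra is a triple $(L,\cdot,[\;,\;])$ where $(L,\cdot)$ is a commutative associative algebra, $(L,[\;,\;])$ is a Lie algebra, and $2z\cdot[x,y]=[z\cdot x,y]+[x,z\cdot y]$ for all $x,y,z\in L$. *)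

(* Defs.v *)
From mathcomp Require Import all_boot all_order all_algebra.

Set Implicit Arguments.
Unset Strict Implicit.
Unset Printing Implicit Defensive.

Import GRing.Theory.
Local Open Scope ring_scope.

(* The operations live on a bare left K-module, i.e. a K-vector space of
   arbitrary dimension; no unit is required for any of the products. *)

Definition bilinear_op (K : fieldType) (L : lmodType K) (op : L -> L -> L) :
  Prop := bilinear_for *:%R *:%R op.

Record comm_assoc_algebra (K : fieldType) (L : lmodType K)
    (dot : L -> L -> L) : Prop := CommAssocAlgebra {
  dot_bilinear : bilinear_op dot;
  dot_comm : commutative dot;
  dot_assoc : associative dot
}.

Record pre_lie_algebra (K : fieldType) (L : lmodType K)
    (circ : L -> L -> L) : Prop := PreLieAlgebra {
  circ_bilinear : bilinear_op circ;
  pre_lie_identity : forall x y z : L,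
    circ (circ x y) z - circ (circ y x) z =
    circ x (circ y z) - circ y (circ x z)
}.

Record pre_lie_poisson_algebra (K : fieldType) (L : lmodType K)
    (dot circ : L -> L -> L) : Prop := PreLiePoissonAlgebra {
  plp_comm_assoc : comm_assoc_algebra dot;
  plp_pre_lie : pre_lie_algebra circ;
  plp_circ_dotl : forall x y z : L, circ (dot x y) z = dot x (circ y z);
  plp_circ_dotr : forall x y z : L,
    dot (circ x y) z - dot (circ y x) z =
    circ x (dot y z) - circ y (dot x z)
}.

Record lie_algebra (K : fieldType) (L : lmodType K)
    (br : L -> L -> L) : Prop := LieAlgebra {
  lie_bilinear : bilinear_op br;
  lie_alternating : forall x : L, br x x = 0;
  lie_jacobi : forall x y z : L,
    br x (br y z) + br y (br z x) + br z (br x y) = 0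
}.

Record transposed_poisson_algebra (K : fieldType) (L : lmodType K)
    (dot br : L -> L -> L) : Prop := TransposedPoissonAlgebra {
  tp_comm_assoc : comm_assoc_algebra dot;
  tp_lie : lie_algebra br;
  tp_identity : forall x y z : L,
    (2 : K) *: dot z (br x y) = br (dot z x) y + br x (dot z y)
}.

Definition commutator (K : fieldType) (L : lmodType K) (circ : L -> L -> L)
  (x y : L) : L := circ x y - circ y x.

(* Main.v *)
Require Import Defs.
From mathcomp Require Import all_boot all_order all_algebra.

(** The commutator of a pre-Lie product is a Lie bracket: the pre-Lie identity
    rewrites the difference (y o z) o x - (z o y) o x occurring in [x, [y, z]]
    so that only right-nested products remain ([commutator_nested]), and these
    telescope in the cyclic sum ([commutator_lie]).  For the compatibility
    condition, the first pre-Lie Poisson axiom turns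
    (z . x) o y - (z . y) o x into z . [x, y], and the second turns
    x o (z . y) - y o (z . x) into z . [x, y] too; the sum of the two is
    [z . x, y] + [x, z . y] ([commutator_transposed]). *)

Import GRing.Theory.
Local Open Scope ring_scope.

Lemma bilinear_op_subl {K : fieldType} {L : lmodType K} {op : L -> L -> L}
    (bil : bilinear_op op) (x y z : L) :
  op (x - y) z = op x z - op y z.
Proof.
case: bil => linl _; have /= lin := linl z (-1) y x.
by rewrite !scaleN1r in lin; rewrite addrC lin addrC.
Qed.

Lemma bilinear_op_subr {K : fieldType} {L : lmodType K} {op : L -> L -> L}
    (bil : bilinear_op op) (x y z : L) :
  op z (x - y) = op z x - op z y.
Proof.
case: bil => _ linr; have /= lin := linr z (-1) y x.
by rewrite !scaleN1r in lin; rewrite addrC lin addrC.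
Qed.

Lemma commutator_bilinear (K : fieldType) (L : lmodType K) (circ : L -> L -> L) :
  bilinear_op circ -> bilinear_op (commutator circ).
Proof.
move=> [linl linr]; split=> u a x y; rewrite /commutator.
- by rewrite linl linr opprD addrACA -scalerBr.
- by rewrite linl linr opprD addrACA -scalerBr.
Qed.

(** Left multiplications represent the commutator, so an iterated bracket is a
    combination of right-nested products. *)
Lemma commutator_nested (K : fieldType) (L : lmodType K) (circ : L -> L -> L)
    (x y z : L) :
  pre_lie_algebra circ ->
  commutator circ x (commutator circ y z) =
  (circ x (circ y z) - circ y (circ z x)) -
  (circ x (circ z y) - circ z (circ y x)).
Proof.
case=> bil plid; rewrite /commutator.
rewrite (bilinear_op_subl bil) (bilinear_op_subr bil) plid.
by rewrite opprD addrACA -opprD.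
Qed.

Lemma commutator_lie (K : fieldType) (L : lmodType K) (circ : L -> L -> L) :
  pre_lie_algebra circ -> lie_algebra (commutator circ).
Proof.
move=> plie; split=> [|x|x y z].
- exact: commutator_bilinear (circ_bilinear plie).
- exact: subrr.
(* Both orientations of right-nested products telescope separately. *)
have telescope (a b c : L) : a - b + (b - c) + (c - a) = 0.
  by rewrite !subrKA subrr.
rewrite !commutator_nested // [X in X + _]addrACA -opprD addrACA -opprD telescope sub0r.
by rewrite addrAC telescope oppr0.
Qed.

Lemma commutator_transposed (K : fieldType) (L : lmodType K)
    (dot circ : L -> L -> L) (x y z : L) :
  pre_lie_poisson_algebra dot circ ->
  (2 : K) *: dot z (commutator circ x y) =
  commutator circ (dot z x) y + commutator circ x (dot z y).
Proof.
case=> [[bil dotC _] _ dotl dotr]; rewrite /commutator.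
have outer : circ x (dot z y) - circ y (dot z x) =
             dot z (circ x y) - dot z (circ y x).
  by rewrite (dotC z y) (dotC z x) -dotr !(dotC z).
rewrite !dotl (bilinear_op_subr bil) scaler_nat mulr2n -{2}outer.
by rewrite addrACA [RHS]addrACA -!opprD [X in _ = _ - X]addrC.
Qed.

Theorem proposition3p10 (K : fieldType) (char0 : [pchar K] =i pred0)
    (L : lmodType K) (dot circ : L -> L -> L)
    (plp : pre_lie_poisson_algebra dot circ) :
  transposed_poisson_algebra dot (commutator circ).
Proof.
split=> [||x y z].
- exact: plp_comm_assoc plp.
- exact: commutator_lie (plp_pre_lie plp).
- exact: commutator_transposed.
Qed.
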